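(* Let $K:\mathbb{Z}^2\to(0,\infty)$. Then $K$ admits detailed balancing if and only if $K$ satisfies the extended Becker-Döring assumption.
   Context: $K$ admits detailed balancing if there exists $g:\mathbb{Z}\to(0,\infty)$ such that $$K(k,l-1)g(k)g(l-1)=K(l,k-1)g(l)g(k-1)\quad\text{for all }k,l\in\mathbb{Z}.$$ $K$ satisfies the extended Becker-Döring assumption if all of the following hold: $$\frac{K(k,l-1)}{K(l,k-1)}=\frac{K(k,0)K(1,l-1)}{K(l,0)K(1,k-1)}\quad\text{for all }k,l\ge1,$$ $$\frac{K(k,l-1)}{K(l,k-1)}=\frac{K(0,l-1)}{K(0,k-1)}\,\frac{K(k,-1)}{K(l,-1)}\quad\text{for all }k,l\le0,$$ $$\frac{K(k,l-1)}{K(l,k-1)}=\frac{K(k,0)}{K(1,k-1)}\,\frac{K(0,l-1)}{K(l,-1)}\,\frac{K(1,-1)}{K(0,0)}\quad\text{for all }k\ge1,\ l\le0,$$ $$\frac{K(k,l-1)}{K(l,k-1)}=\frac{K(1,l-1)}{K(l,0)}\,\frac{K(k,-1)}{K(0,k-1)}\,\frac{K(0,0)}{K(1,-1)}\quad\text{for all }k\le0,\ l\ge1.$$ *)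

(* Defs.v *)
From Stdlib Require Import Reals ZArith.
Open Scope R_scope.

Definition detailed_balancing (K : Z -> Z -> R) : Prop :=
  exists g : Z -> R,
    (forall k : Z, 0 < g k) /\
    (forall k l : Z,
        K k (l - 1)%Z * g k * g (l - 1)%Z = K l (k - 1)%Z * g l * g (k - 1)%Z).

Definition extended_Becker_Doring (K : Z -> Z -> R) : Prop :=
  (forall k l : Z, (1 <= k)%Z -> (1 <= l)%Z ->
     K k (l - 1)%Z / K l (k - 1)%Z =
     (K k 0%Z * K 1%Z (l - 1)%Z) / (K l 0%Z * K 1%Z (k - 1)%Z)) /\
  (forall k l : Z, (k <= 0)%Z -> (l <= 0)%Z ->
     K k (l - 1)%Z / K l (k - 1)%Z =
     K 0%Z (l - 1)%Z / K 0%Z (k - 1)%Z * (K k (-1)%Z / K l (-1)%Z)) /\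
  (forall k l : Z, (1 <= k)%Z -> (l <= 0)%Z ->
     K k (l - 1)%Z / K l (k - 1)%Z =
     K k 0%Z / K 1%Z (k - 1)%Z * (K 0%Z (l - 1)%Z / K l (-1)%Z)
       * (K 1%Z (-1)%Z / K 0%Z 0%Z)) /\
  (forall k l : Z, (k <= 0)%Z -> (1 <= l)%Z ->
     K k (l - 1)%Z / K l (k - 1)%Z =
     K 1%Z (l - 1)%Z / K l 0%Z * (K k (-1)%Z / K 0%Z (k - 1)%Z)
       * (K 0%Z 0%Z / K 1%Z (-1)%Z)).

(* Main.v *)
(** With [r k = g k / g (k-1)], detailed balancing says exactly that
    [K(k,l-1) / K(l,k-1) = r l / r k] for some positive [r]; any positive [r] arises
    this way, by taking products. Setting [l = 1] or [l = 0] determines [r] up to a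
    constant on [k >= 1] and on [k <= 0], and the pair [(1,0)] links the two constants;
    the extended Becker-Döring identities say that the [r] read off in this way works. *)

Require Import Defs.
From Stdlib Require Import Reals ZArith Lia Lra.
Open Scope R_scope.

Section IntegerProducts.

Variable q : Z -> R.
Hypothesis q_pos : forall k, 0 < q k.

Fixpoint prod_up (n : nat) : R :=
  match n with
  | O => 1
  | S m => prod_up m * q (Z.of_nat (S m))
  end.

(** The value at [-n] of the solution equal to 1 at 0: stepping down from [-m] to [-m - 1] divides
    by [q (-m)], so the factors start at [q 0], whereas those of [prod_up] start at [q 1]. *)
Fixpoint prod_down (n : nat) : R :=
  match n with
  | O => 1
  | S m => prod_down m / q (- Z.of_nat m)%Z
  end.

Lemma prod_up_pos (n : nat) : 0 < prod_up n.
Proof.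
  induction n as [|n IH]; cbn [prod_up]; [lra|].
  now apply Rmult_lt_0_compat.
Qed.

Lemma prod_down_pos (n : nat) : 0 < prod_down n.
Proof.
  induction n as [|n IH]; cbn [prod_down]; [lra|].
  now apply Rdiv_lt_0_compat.
Qed.

Lemma exists_with_increments :
  exists g : Z -> R, (forall k, 0 < g k) /\ (forall k, g k = q k * g (k - 1)%Z).
Proof.
  (* At every [k] at least one of the two factors is the empty product. *)
  exists (fun k => prod_up (Z.to_nat k) * prod_down (Z.to_nat (- k))).
  split; intros k.
  - apply Rmult_lt_0_compat; [apply prod_up_pos | apply prod_down_pos].
  - destruct (Z_le_gt_dec k 0) as [Hk|Hk].
    + replace (Z.to_nat k) with O by lia.
      replace (Z.to_nat (k - 1)) with O by lia.
      replace (Z.to_nat (- (k - 1))) with (S (Z.to_nat (- k))) by lia.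
      cbn [prod_up prod_down].
      replace (- Z.of_nat (Z.to_nat (- k)))%Z with k by lia.
      field. apply Rgt_not_eq, q_pos.
    + replace (Z.to_nat (- k)) with O by lia.
      replace (Z.to_nat (- (k - 1))) with O by lia.
      replace (Z.to_nat k) with (S (Z.to_nat (k - 1))) by lia.
      cbn [prod_up prod_down].
      replace (Z.of_nat (S (Z.to_nat (k - 1)))) with k by lia.
      ring.
Qed.

End IntegerProducts.

Lemma detailed_balancing_iff_ratio (K : Z -> Z -> R) (K_pos : forall k l : Z, 0 < K k l) :
  detailed_balancing K <->
  exists r : Z -> R, (forall k, 0 < r k) /\
    (forall k l, K k (l - 1)%Z / K l (k - 1)%Z = r l / r k).
Proof.
  assert (K_neq : forall k l, K k l <> 0) by (intros; apply Rgt_not_eq, K_pos).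
  split.
  - intros [g [g_pos Hg]].
    assert (g_neq : forall k, g k <> 0) by (intros; apply Rgt_not_eq, g_pos).
    exists (fun k => g k / g (k - 1)%Z). split.
    + intros k. now apply Rdiv_lt_0_compat.
    + intros k l.
      replace (K k (l - 1)%Z) with
        (K k (l - 1)%Z * g k * g (l - 1)%Z / (g k * g (l - 1)%Z))
        by (field; auto).
      rewrite Hg. field. auto.
  - intros [r [r_pos Hr]].
    assert (r_neq : forall k, r k <> 0) by (intros; apply Rgt_not_eq, r_pos).
    destruct (exists_with_increments r r_pos) as [g [g_pos Hg]].
    exists g. split; [exact g_pos|]. intros k l.
    (* Both sides now carry the common factor [g (k - 1) * g (l - 1)]; what remains is the ratio
       identity. *)
    rewrite (Hg k), (Hg l).
    replace (K k (l - 1)%Z) with (K k (l - 1)%Z / K l (k - 1)%Z * K l (k - 1)%Z)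
      by (field; auto).
    rewrite Hr. field. auto.
Qed.

Theorem theorem5p6 (K : Z -> Z -> R) (K_pos : forall k l : Z, 0 < K k l) :
  detailed_balancing K <-> extended_Becker_Doring K.
Proof.
  assert (K_neq : forall k l, K k l <> 0) by (intros; apply Rgt_not_eq, K_pos).
  rewrite (detailed_balancing_iff_ratio K K_pos).
  split.
  - intros [r [r_pos Hr]].
    assert (r_neq : forall k, r k <> 0) by (intros; apply Rgt_not_eq, r_pos).
    (* The ratio identity at [l = 1] and [l = 0] expresses the boundary values of [K] through [r];
       after substitution the remaining values of [K] cancel. *)
    assert (H1 : forall k, K k 0%Z = r 1%Z / r k * K 1%Z (k - 1)%Z).
    { intros k. rewrite <- Hr. change (1 - 1)%Z with 0%Z. field. auto. }
    assert (H0 : forall k, K k (-1)%Z = r 0%Z / r k * K 0%Z (k - 1)%Z).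
    { intros k. rewrite <- Hr. change (0 - 1)%Z with (-1)%Z. field. auto. }
    assert (H10 : K 1%Z (-1)%Z = r 0%Z / r 1%Z * K 0%Z 0%Z) by exact (H0 1%Z).
    repeat split; intros k l _ _; rewrite Hr.
    + rewrite (H1 k), (H1 l). field. auto.
    + rewrite (H0 k), (H0 l). field. auto.
    + rewrite H10, (H1 k), (H0 l). field. auto 10.
    + rewrite H10, (H0 k), (H1 l). field. auto 10.
  - intros [B1 [B2 [B3 B4]]].
    (* Normalised by [r 1 = 1]; the pair [(1, 0)] then forces [r 0 = K 1 (-1) / K 0 0], the constant
       factor of the second branch. *)
    exists (fun k => if Z_le_gt_dec 1 k then K 1%Z (k - 1)%Z / K k 0%Z
      else K 0%Z (k - 1)%Z / K k (-1)%Z * (K 1%Z (-1)%Z / K 0%Z 0%Z)).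
    split.
    + intros k. destruct (Z_le_gt_dec 1 k);
        repeat (apply Rdiv_lt_0_compat || apply Rmult_lt_0_compat); apply K_pos.
    + intros k l.
      (* Each sign pattern is one of the four identities; the factor [r 0] cancels when [k] and [l]
         lie on the same side and survives in the mixed cases. *)
      destruct (Z_le_gt_dec 1 k), (Z_le_gt_dec 1 l);
        [rewrite B1 by lia | rewrite B3 by lia | rewrite B4 by lia | rewrite B2 by lia];
        field; auto 10.
Qed.
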